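(* Let $\alpha: I\subset\mathbb{R}\to\mathbb{E}^3$ be a curve with curvature $\kappa>0$ and let $f$ be an integrable nonzero function. Then $\alpha$ is an $f$-rectifying curve if and only if, up to parametrization, it is given by $$\alpha(t)=\frac{c\sec(t+t_0)}{f\big(F^{-1}(c\tan(t+t_0))\big)}\,Y(t)-c^2\int f'\big(F^{-1}(c\tan(t+t_0))\big)\left(\frac{\sec(t+t_0)}{f\big(F^{-1}(c\tan(t+t_0))\big)}\right)^{3}Y(t)\,dt,$$ where $c$ is a strictly positive number, $F$ is a primitive function of $f$ with $F(0)=c\tan t_0$, and $Y(t)$ is a curve in $\mathbb{S}^2$ which is not an arc of a great circle.
   Context: $\mathbb{E}^3$ is Euclidean 3-space with standard inner product, and $\mathbb{S}^2$ is its unit sphere centered at the origin. For a curve $\alpha$ parametrized by arclength $s$, $T=\alpha'$ is the unit tangent, $\kappa=|T'|$ the curvature, and (where $\kappa\neq0$) $N$ the principal normal, $B=T\times N$ the binormal, and $\tau$ the torsion, so that $T'=\kappa N$, $N'=-\kappa T+\tau B$, $B'=-\tau N$. The rectifying plane at $s$ is the plane spanned by $T(s)$ and $B(s)$. For an integrable function $f$ of the arclength parameter $s$, the $f$-position vector of $\alpha$ is $\alpha_f(s)=\int f(s)T(s)\,ds$, i.e. an antiderivative of $fT$. The curve $\alpha$ is called $f$-rectifying if its $f$-position vector always lies in the rectifying plane of $\alpha$, i.e. $\alpha_f(s)=\lambda(s)T(s)+\mu(s)B(s)$ for some real functions $\lambda,\mu$. A primitive of $f$ is a function $F$ with $F'=f$;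 $F^{-1}$ is the inverse function of $F$, and $f'$ the derivative of $f$.
   Formalization: The integral term is taken with a plus sign, since the printed minus sign makes the claim false (e.g. f(s)=e^s on the real line); f is assumed differentiable and nowhere zero, as the formula with f' and 1/f requires. *)

(* Defs.v *)
(* MathComp / MathComp-Analysis. *)
From HB Require Import structures.
From mathcomp Require Import all_boot all_order all_algebra.
From mathcomp Require Import all_classical all_reals all_analysis.

Set Implicit Arguments.
Unset Strict Implicit.
Unset Printing Implicit Defensive.

Import Order.TTheory GRing.Theory Num.Theory.
Import numFieldNormedType.Exports.
Local Open Scope ring_scope.
Local Open Scope classical_set_scope.

(* Euclidean 3-space is 'rV[R]_3.  The library norm on row vectors is the sup
   norm; it induces the same topology, hence the same derivatives, but lengths
   must be measured with [enorm]. *)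
Definition dot (R : realType) (u v : 'rV[R]_3) : R :=
  \sum_(i < 3) u 0 i * v 0 i.

Definition enorm (R : realType) (u : 'rV[R]_3) : R := Num.sqrt (dot u u).

(* The column indices live in 'I_3, so k + 1 and k + 2 are taken modulo 3. *)
Definition cross (R : realType) (u v : 'rV[R]_3) : 'rV[R]_3 :=
  \row_(k < 3) (u 0 (k + 1) * v 0 (k + 2) - u 0 (k + 2) * v 0 (k + 1)).

Definition sphere2 (R : realType) : set 'rV[R]_3 := [set p | enorm p = 1].
Arguments sphere2 : clear implicits.

(* The great circle of pole direction n, for n != 0. *)
Definition great_circle (R : realType) (n : 'rV[R]_3) : set 'rV[R]_3 :=
  sphere2 R `&` [set p | dot n p = 0].

Definition great_circle_arc (R : realType) (J : set R) (Y : R -> 'rV[R]_3) :=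
  exists2 n : 'rV[R]_3, n != 0 & Y @` J `<=` great_circle n.

(* Twice differentiable is all the frame T, N, B requires. *)
Definition is_curve (R : realType) (I : set R) (g : R -> 'rV[R]_3) :=
  forall s, I s -> derivable g s 1 /\ derivable (derive1 g) s 1.

Definition unit_speed (R : realType) (I : set R) (g : R -> 'rV[R]_3) :=
  forall s, I s -> enorm (derive1 g s) = 1.

Section frame.
Context (R : realType) (alpha : R -> 'rV[R]_3).

Definition tangent : R -> 'rV[R]_3 := derive1 alpha.

Definition curvature (s : R) : R := enorm (derive1 tangent s).

Definition normal (s : R) : 'rV[R]_3 := (curvature s)^-1 *: derive1 tangent s.

Definition binormal (s : R) : 'rV[R]_3 := cross (tangent s) (normal s).

End frame.

Definition antiderivative (R : realType) (V : normedModType R) (I : set R)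
    (g G : R -> V) :=
  forall x, I x -> is_derive x 1 G (g x).

(* The f-position vector is an indefinite integral, so the constant of
   integration is part of the existential. *)
Definition f_rectifying (R : realType) (I : set R) (alpha : R -> 'rV[R]_3)
    (f : R -> R) :=
  exists alpha_f : R -> 'rV[R]_3,
    antiderivative I (fun s => f s *: tangent alpha s) alpha_f /\
    exists lambda mu : R -> R, forall s, I s ->
      alpha_f s = lambda s *: tangent alpha s + mu s *: binormal alpha s.

Definition sec (R : realType) (x : R) : R := (cos x)^-1.

(* Main.v *)
Require Import Defs.
From HB Require Import structures.
From mathcomp Require Import all_boot all_order all_algebra.
From mathcomp Require Import all_classical all_reals all_analysis.
From mathcomp Require Import ring lra.

Set Implicit Arguments.
Unset Strict Implicit.
Unset Printing Implicit Defensive.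

Import Order.TTheory GRing.Theory Num.Theory.
Import numFieldNormedType.Exports.
Local Open Scope ring_scope.
Local Open Scope classical_set_scope.

(** Being f-rectifying means that an antiderivative A of f T is orthogonal to
    T', the plane spanned by T and B being the orthogonal of N = T' / kappa.

    Suppose A is such an antiderivative. The tangential component F = <A, T> has
    derivative f <T, T> + <A, T'> = f, so it is a primitive of f, and
    (|A|^2)' = 2 f <A, T> = 2 F F' makes |A|^2 - F^2 a constant. It is the square
    of the binormal component of A, hence nonnegative; if it vanished, A = F T
    would differentiate to f T = f T + F T', and T' <> 0 would force F = 0, hence
    f = F' = 0.
    So |A|^2 = c^2 + F^2 with c > 0, and A is c sec(t + t0) times a unit vector
    Y once t is the angle with F = c tan(t + t0). As f does not vanish, F is
    invertible, s = F^-1(c tan(t + t0)) satisfies ds/dt = c sec^2(t + t0) / f,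
    and integrating T ds = f^-1 dA by parts gives the formula for alpha
    ([f_rectifying_spherical_param]). If Y stayed in a plane orthogonal to n, so
    would A, then T and T' by differentiation, then B since the component of A
    along B is nonzero; thus n = 0.

    Conversely, differentiating the formula shows that
    A = c sec(t + t0) Y, as a function of s, is an antiderivative of f T with
    |A|^2 = c^2 + F^2. Differentiating this identity gives <A, T> = F, and
    differentiating once more gives f + <A, T'> = f, that is <A, T'> = 0
    ([spherical_param_f_rectifying]).

    Both parameter changes s(t) and t(s) are inverses of functions with
    nonvanishing derivative on an open interval, so a single inverse function
    theorem for [pinv] serves both; derivatives of curves are computed
    coordinatewise. *)

(** * Functions with nonvanishing derivative on an interval *)

Section Interval.
Context (R : realType).
Implicit Types (I : set R) (h dh : R -> R).

Lemma is_derive_continuous h (x d : R) : is_derive x 1 h d -> {for x, continuous h}.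
Proof. by case=> /derivable1_diffP/differentiable_continuous. Qed.

Lemma MVT_interval I h dh a b : is_interval I ->
  (forall x, I x -> is_derive x 1 h (dh x)) -> I a -> I b -> a < b ->
  exists2 x, I x & h b - h a = dh x * (b - a).
Proof.
move=> I_itv hD Ia Ib ab.
have sub x : x \in `[a, b]%R -> I x.
  by rewrite in_itv /= => axb; exact: I_itv Ia Ib _ axb.
have [x xab ->] : exists2 x, x \in `]a, b[%R & h b - h a = dh x * (b - a).
  apply: MVT => // [x /subset_itv_oo_cc /sub /hD //|].
  by apply: derivable_within_continuous => x /sub /hD [].
by exists x => //; apply/sub/subset_itv_oo_cc.
Qed.

Lemma derive0_cst_interval I h : is_interval I ->
  (forall x, I x -> is_derive x 1 h 0) -> forall a b, I a -> I b -> h a = h b.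
Proof.
move=> I_itv hD a b; wlog ab : a b / a < b => [wl Ia Ib|Ia Ib].
  by case: (ltgtP a b) => [ab|ba|->//]; [|apply/esym]; exact: wl.
have [x _] := MVT_interval (dh := fun=> 0) I_itv hD Ia Ib ab.
by rewrite mul0r => /eqP; rewrite subr_eq0 => /eqP ->.
Qed.

Lemma derive_neq0_inj I h dh : is_interval I ->
  (forall x, I x -> is_derive x 1 h (dh x)) -> (forall x, I x -> dh x != 0) ->
  {in I &, injective h}.
Proof.
move=> I_itv hD dh0 a b /set_mem Ia /set_mem Ib.
wlog ab : a b Ia Ib / a < b => [wl hab|hab].
  by case: (ltgtP a b) => [ab|ba|//]; [|apply/esym]; apply: wl.
have [x Ix] := MVT_interval I_itv hD Ia Ib ab.
rewrite hab subrr => /esym/eqP; rewrite mulf_eq0 (negPf (dh0 _ Ix)) /=.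
by rewrite subr_eq0 gt_eqF.
Qed.

Lemma pinv_image_mem I h y : (h @` I) y -> I (pinv I h y) /\ h (pinv I h y) = y.
Proof.
move=> hy; split; last by apply: pinvK; rewrite inE.
have sub := @surjpinv_image_sub _ _ (fun=> point) I (h @` I) h (fun=> id).
by apply: sub; exists y.
Qed.

Lemma is_interval_derivable_image I h dh : is_interval I ->
  (forall x, I x -> is_derive x 1 h (dh x)) -> is_interval (h @` I).
Proof.
move=> /connected_intervalP I_conn hD; apply/connected_intervalP.
apply: connected_continuous_connected => //.
apply: continuous_in_subspaceT => x /set_mem /hD; exact: is_derive_continuous.
Qed.

Section Inverse.
Context (I : set R) (h dh : R -> R).
Hypotheses (I_open : open I) (I_itv : is_interval I).
Hypothesis hD : forall x, I x -> is_derive x 1 h (dh x).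
Hypothesis dh0 : forall x, I x -> dh x != 0.

Lemma pinv_derivableK x : I x -> pinv I h (h x) = x.
Proof.
by move=> Ix; apply: pinvKV; [exact: derive_neq0_inj I_itv hD dh0|rewrite inE].
Qed.

Let near_pinvK x : I x -> {near x, cancel h (pinv I h)}.
Proof.
move=> Ix; near=> y; apply: pinv_derivableK; near: y.
exact: open_nbhs_nbhs.
Unshelve. all: by end_near. Qed.

Let near_cont x : I x -> {near x, continuous h}.
Proof.
move=> Ix; near=> y; apply: (is_derive_continuous (d := dh y)); apply: hD.
by near: y; exact: open_nbhs_nbhs.
Unshelve. all: by end_near. Qed.

Lemma is_derive_pinv x : I x -> is_derive (h x) 1 (pinv I h) (dh x)^-1.
Proof.
move=> Ix; apply: is_derive_inverse; [exact: near_pinvK|exact: near_cont| |].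
- exact: hD.
- exact: dh0.
Qed.

(** Near h x the function [pinv I h] is continuous, hence has values in the open
    set I, and is a right inverse of h: every y close to h x is attained. *)
Lemma open_derivable_image : open (h @` I).
Proof.
rewrite openE => _ [x Ix <-].
have [gC gK] := near_can_continuousAcan_sym (near_pinvK Ix) (near_cont Ix).
have gx : pinv I h (h x) = x := pinv_derivableK Ix.
have gI : \forall y \near h x, I (pinv I h y).
  have := nbhs_singleton gC; apply; rewrite gx; exact: open_nbhs_nbhs.
rewrite /interior; near=> y; exists (pinv I h y); first by near: y.
by near: y.
Unshelve. all: by end_near. Qed.

End Inverse.
End Interval.

(** * Dot and cross products in dimension three *)

Section DotCross.
Context (R : realType).
Implicit Types (u v w : 'rV[R]_3) (a : R).

Lemma dotE u v : dot u v = u 0 0 * v 0 0 + u 0 1 * v 0 1 + u 0 2 * v 0 2.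
Proof.
rewrite /dot !big_ord_recl big_ord0 addr0 addrA.
by congr (_ + _ + _); congr (u 0 _ * v 0 _); apply/val_inj.
Qed.

Lemma dotC u v : dot u v = dot v u.
Proof. by rewrite !dotE; ring. Qed.

Lemma dotDr u v w : dot u (v + w) = dot u v + dot u w.
Proof. by rewrite !dotE !mxE; ring. Qed.

Lemma dotZr a u v : dot u (a *: v) = a * dot u v.
Proof. by rewrite !dotE !mxE; ring. Qed.

Lemma dotDl u v w : dot (u + v) w = dot u w + dot v w.
Proof. by rewrite dotC dotDr !(dotC w). Qed.

Lemma dotZl a u v : dot (a *: u) v = a * dot u v.
Proof. by rewrite dotC dotZr dotC. Qed.

Lemma dot_ge0 u : 0 <= dot u u.
Proof. by apply: sumr_ge0 => i _; rewrite -expr2 sqr_ge0. Qed.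

Lemma dot_eq0 u : dot u u = 0 -> u = 0.
Proof.
move=> u0; apply/rowP => i; rewrite mxE; apply/eqP.
have /psumr_eq0P : forall i : 'I_3, true -> 0 <= u 0 i * u 0 i.
  by move=> j _; rewrite -expr2 sqr_ge0.
by move=> /(_ u0 i isT) /eqP; rewrite mulf_eq0 orbb.
Qed.

Lemma enorm_sqr u : enorm u ^+ 2 = dot u u.
Proof. by rewrite sqr_sqrtr // dot_ge0. Qed.

Lemma enorm_eq1 u : (enorm u = 1) <-> (dot u u = 1).
Proof.
split=> [u1|u1]; first by rewrite -enorm_sqr u1 expr1n.
by rewrite /enorm u1 sqrtr1.
Qed.

Lemma crossE u v :
  [/\ cross u v 0 0 = u 0 1 * v 0 2 - u 0 2 * v 0 1,
      cross u v 0 1 = u 0 2 * v 0 0 - u 0 0 * v 0 2 &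
      cross u v 0 2 = u 0 0 * v 0 1 - u 0 1 * v 0 0].
Proof.
by split; rewrite mxE; congr (u 0 _ * v 0 _ - u 0 _ * v 0 _); apply/val_inj.
Qed.

Lemma dot_cross_l u v : dot u (cross u v) = 0.
Proof. by rewrite dotE; have [-> -> ->] := crossE u v; ring. Qed.

Lemma dot_cross_r u v : dot v (cross u v) = 0.
Proof. by rewrite dotE; have [-> -> ->] := crossE u v; ring. Qed.

Lemma dot_cross_cross u v :
  dot (cross u v) (cross u v) = dot u u * dot v v - dot u v ^+ 2.
Proof. by rewrite !dotE; have [-> -> ->] := crossE u v; ring. Qed.

Lemma cross_double u v w : cross w (cross u v) = dot w v *: u - dot w u *: v.
Proof.
have [c0 c1 c2] := crossE u v; have [d0 d1 d2] := crossE w (cross u v).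
apply/rowP => i; rewrite !dotE.
have [->|->|->] : [\/ i = 0, i = 1 | i = 2].
- case: i => [[|[|[|//]]] ?]; [constructor 1|constructor 2|constructor 3];
    exact/val_inj.
- by rewrite d0 c1 c2 !mxE; ring.
- by rewrite d1 c0 c2 !mxE; ring.
- by rewrite d2 c0 c1 !mxE; ring.
Qed.

(** Lagrange's identity turns the vanishing of w x (u x v), given by the double
    product expansion, into that of |w|^2 |u x v|^2. *)
Lemma orthogonal_frame_eq0 u v w : dot (cross u v) (cross u v) != 0 ->
  dot w u = 0 -> dot w v = 0 -> dot w (cross u v) = 0 -> w = 0.
Proof.
move=> uv0 wu wv wuv; apply: dot_eq0; apply/eqP.
have := dot_cross_cross w (cross u v).
rewrite cross_double wu wv wuv !scale0r subrr expr0n subr0.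
rewrite (_ : dot 0 0 = 0); last by rewrite -(scale0r 0) dotZl mul0r.
by move=> /esym/eqP; rewrite mulf_eq0 (negPf uv0) orbF.
Qed.

End DotCross.

(** * Derivatives of curves *)

Section RowCalculus.
Context (R : realType).
Implicit Types (u v : R -> 'rV[R]_3) (a : R -> R).

Lemma is_derive_rowP u (x : R) (du : 'rV[R]_3) :
  is_derive x 1 u du <-> forall i, is_derive x 1 (fun t => u t 0 i) (du 0 i).
Proof.
split=> [[uD <-] i|uD].
  rewrite derive_mx // mxE; apply/derivableP.
  exact: (derivable_mxP u x 1).1.
have uD' : derivable u x 1.
  by apply/derivable_mxP => i j; rewrite ord1; have [] := uD j.
apply: DeriveDef => //; rewrite derive_mx //; apply/rowP => j.
by rewrite mxE; have [] := uD j.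
Qed.

Lemma is_derive_dot u v (x : R) du dv :
  is_derive x 1 u du -> is_derive x 1 v dv ->
  is_derive x 1 (fun t => dot (u t) (v t)) (dot (u x) dv + dot du (v x)).
Proof.
move=> /is_derive_rowP uD /is_derive_rowP vD.
have -> : (fun t => dot (u t) (v t)) =
  \sum_(i < 3) ((fun t => u t 0 i) * (fun t => v t 0 i)).
  by apply/funext => t; rewrite fct_sumE.
have -> : dot (u x) dv + dot du (v x) =
  \sum_(i < 3) (u x 0 i *: dv 0 i + v x 0 i *: du 0 i).
  rewrite big_split /=; congr (_ + _).
  by apply: eq_bigr => i _; rewrite mulrC.
by apply: is_derive_sum => i; apply: is_deriveM.
Qed.

Lemma is_derive_scale a u (x da : R) du :
  is_derive x 1 a da -> is_derive x 1 u du ->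
  is_derive x 1 (fun t => a t *: u t) (a x *: du + da *: u x).
Proof.
move=> aD /is_derive_rowP uD; apply/is_derive_rowP => i.
have -> : (fun t => (a t *: u t) 0 i) = a * (fun t => u t 0 i).
  by apply/funext => t; rewrite mxE.
by rewrite !mxE [da * _]mulrC; apply: is_deriveM.
Qed.

Lemma is_derive_comp_row u a (x da : R) du :
  is_derive (a x) 1 u du -> is_derive x 1 a da ->
  is_derive x 1 (fun t => u (a t)) (da *: du).
Proof.
move=> /is_derive_rowP uD aD; apply/is_derive_rowP => i.
rewrite mxE mulrC.
exact: (@is_derive1_comp _ (fun t => u t 0 i) a).
Qed.

Lemma eq_open_is_derive (V : normedModType R) (I : set R) (g h : R -> V) (x : R) d :
  open I -> {in I, g =1 h} -> I x -> is_derive x 1 g d -> is_derive x 1 h d.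
Proof.
move=> I_open gh Ix; apply: near_eq_is_derive.
near=> y; apply: gh; rewrite inE; near: y; exact: open_nbhs_nbhs.
Unshelve. all: by end_near. Qed.

Lemma is_derive_divr g (x d c : R) :
  is_derive x 1 g d -> is_derive x 1 (fun t => g t / c) (d / c).
Proof.
move=> gD; rewrite mulrC; have := is_deriveZ c^-1 gD.
by congr is_derive; apply/funext => t; rewrite mulrC.
Qed.

Lemma is_derive_unique (V : normedModType R) (g : R -> V) (x : R) d e :
  is_derive x 1 g d -> is_derive x 1 g e -> d = e.
Proof. by case=> _ <- [_ <-]. Qed.

Lemma dot_derive_eq0 (I : set R) (n : 'rV[R]_3) u (x : R) du : open I ->
  (forall y, I y -> dot n (u y) = 0) -> I x -> is_derive x 1 u du -> dot n du = 0.
Proof.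
move=> I_open nu Ix uD; have nuD := is_derive_dot (is_derive_cst n _ _) uD.
have nuD0 : is_derive x 1 (fun y => dot n (u y)) 0.
  by apply: (@eq_open_is_derive R^o I (cst 0)) => // y /set_mem /nu ->.
have := is_derive_unique nuD nuD0.
by rewrite -(scale0r n) dotZl mul0r addr0.
Qed.

Lemma derivable_is_derive1 (V : normedModType R) (g : R -> V) (x : R) :
  derivable g x 1 -> is_derive x 1 g (derive1 g x).
Proof. by move=> /derivableP; rewrite derive1E. Qed.
End RowCalculus.

(** * The secant and tangent parametrization *)

Section Trig.
Context (R : realType).

Lemma sec_sqr (t : R) : cos t != 0 -> sec t ^+ 2 = 1 + tan t ^+ 2.
Proof. by move=> /cos2_tan2; rewrite /sec exprVn. Qed.

Lemma is_derive_addr (t t0 : R) : is_derive t 1 (fun t => t + t0) 1.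
Proof.
rewrite -[X in is_derive _ _ _ X]addr0.
exact: (is_deriveD (is_derive_id _ _) (is_derive_cst t0 _ _)).
Qed.

Lemma is_derive_scaled_tan (c t0 t : R) : cos (t + t0) != 0 ->
  is_derive t 1 (fun t => c * tan (t + t0)) (c * sec (t + t0) ^+ 2).
Proof.
move=> cos0; have tanD : is_derive t 1 (tan \o (fun t => t + t0)) (sec (t + t0) ^+ 2).
  rewrite -[X in is_derive _ _ _ X]mulr1; apply: is_derive1_comp.
    by rewrite /sec exprVn; exact: is_derive_tan.
  exact: is_derive_addr.
exact: (is_deriveZ c tanD).
Qed.

Lemma is_derive_shifted_cos (t0 t : R) :
  is_derive t 1 (fun t => cos (t + t0)) (- sin (t + t0)).
Proof.
rewrite -[X in is_derive _ _ _ X]mulr1.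
exact: (is_derive1_comp (is_derive_cos _) (is_derive_addr _ _)).
Qed.

Lemma is_derive_shifted_sin (t0 t : R) :
  is_derive t 1 (fun t => sin (t + t0)) (cos (t + t0)).
Proof.
rewrite -[X in is_derive _ _ _ X]mulr1.
exact: (is_derive1_comp (is_derive_sin _) (is_derive_addr _ _)).
Qed.

Lemma is_derive_shifted_sec (t0 t : R) : cos (t + t0) != 0 ->
  is_derive t 1 (fun t => sec (t + t0)) (sec (t + t0) ^+ 2 * sin (t + t0)).
Proof.
move=> cos0; have := is_deriveV cos0 (is_derive_shifted_cos t0 t).
by rewrite /sec /GRing.scale /= mulrNN exprVn.
Qed.

End Trig.

(** * The rectifying plane as the orthogonal of the derivative of T *)

Section RectifyingPlane.
Context (R : realType) (I : set R) (alpha : R -> 'rV[R]_3).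
Hypotheses (I_open : open I) (alpha_curve : is_curve I alpha).
Hypothesis alpha_unit : unit_speed I alpha.
Hypothesis kappa_gt0 : forall s, I s -> 0 < curvature alpha s.

Local Notation T := (tangent alpha).
Local Notation T' := (derive1 (tangent alpha)).

Lemma is_derive_curve s : I s -> is_derive s 1 alpha (T s).
Proof. by move=> /alpha_curve [/derivable_is_derive1]. Qed.

Lemma is_derive_tangent s : I s -> is_derive s 1 T (T' s).
Proof. by move=> /alpha_curve [_ /derivable_is_derive1]. Qed.

Lemma dot_tangent s : I s -> dot (T s) (T s) = 1.
Proof. by move=> /alpha_unit /enorm_eq1. Qed.

Lemma dot_tangent_derive s : I s -> dot (T s) (T' s) = 0.
Proof.
move=> Is; have TD := is_derive_tangent Is.
have TT := is_derive_dot TD TD.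
have cst1 : is_derive s 1 (fun x => dot (T x) (T x)) 0.
  apply: (@eq_open_is_derive R R^o I (cst 1)) => // x /set_mem Ix.
  by rewrite /= dot_tangent.
have /eqP := is_derive_unique TT cst1.
by rewrite [dot (T' s) _]dotC -mulr2n mulrn_eq0 => /eqP.
Qed.

Lemma dot_tangent_derive_self s : dot (T' s) (T' s) = curvature alpha s ^+ 2.
Proof. by rewrite enorm_sqr. Qed.

Lemma dot_binormal s : I s -> dot (binormal alpha s) (binormal alpha s) = 1.
Proof.
move=> Is; rewrite dot_cross_cross dot_tangent // !(dotZl, dotZr).
rewrite dot_tangent_derive // dot_tangent_derive_self.
by have /lt0r_neq0 k0 := kappa_gt0 Is; field.
Qed.

Lemma dot_tangent_binormal s : dot (T s) (binormal alpha s) = 0.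
Proof. exact: dot_cross_l. Qed.

Lemma dot_tangent_derive_binormal s :
  I s -> dot (T' s) (binormal alpha s) = 0.
Proof.
move=> Is; have k0 : curvature alpha s != 0 by rewrite gt_eqF // kappa_gt0.
have := dot_cross_r (T s) (normal alpha s); rewrite dotZl => /eqP.
by rewrite mulf_eq0 invr_eq0 (negPf k0) => /eqP.
Qed.

Lemma frame_eq0 s w : I s -> dot w (T s) = 0 -> dot w (T' s) = 0 ->
  dot w (binormal alpha s) = 0 -> w = 0.
Proof.
move=> Is wT wT' wB; apply: (@orthogonal_frame_eq0 _ (T s) (normal alpha s)) => //.
- by rewrite [X in X != 0]dot_binormal // oner_neq0.
- by rewrite dotZr wT' mulr0.
Qed.

(** The difference of the two sides is orthogonal to T, T' and B. *)
Lemma rectifying_planeP s v : I s ->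
  dot v (T' s) = 0 ->
  v = dot v (T s) *: T s + dot v (binormal alpha s) *: binormal alpha s.
Proof.
move=> Is vT'; apply/eqP; rewrite -subr_eq0; apply/eqP.
have sub w : dot (v - (dot v (T s) *: T s
      + dot v (binormal alpha s) *: binormal alpha s)) w
    = dot v w - (dot v (T s) * dot (T s) w
      + dot v (binormal alpha s) * dot (binormal alpha s) w).
  by rewrite -scaleN1r dotDl dotZl dotDl !dotZl mulN1r.
apply: (frame_eq0 Is); rewrite sub.
- by rewrite dot_tangent // [dot (binormal _ _) _]dotC dot_tangent_binormal; ring.
- rewrite vT' dot_tangent_derive // [dot (binormal _ _) _]dotC.
  by rewrite dot_tangent_derive_binormal //; ring.
- by rewrite dot_binormal // dot_tangent_binormal; ring.
Qed.

(** Reduces f-rectifying to one scalar equation, so that the coefficients lambda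
    and mu no longer intervene. *)
Lemma f_rectifyingP (f : R -> R) : f_rectifying I alpha f <->
  exists2 A, antiderivative I (fun s => f s *: T s) A
    & forall s, I s -> dot (A s) (T' s) = 0.
Proof.
split=> [[A [AD [lambda [mu Aeq]]]]|[A AD AT']].
  exists A => // s Is; rewrite Aeq // dotDl !dotZl dot_tangent_derive //.
  by rewrite [dot (binormal _ _) _]dotC dot_tangent_derive_binormal // !mulr0 addr0.
exists A; split=> //; exists (fun s => dot (A s) (T s)).
exists (fun s => dot (A s) (binormal alpha s)) => s Is.
by apply: rectifying_planeP => //; exact: AT'.
Qed.

End RectifyingPlane.

(** * The arclength as a function of the angle *)

Section Arclength.
Context (R : realType) (I : set R) (f F : R -> R).
Hypotheses (I_open : open I) (I_itv : is_interval I).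
Hypotheses (FD : antiderivative I f F) (f_neq0 : forall s, I s -> f s != 0).

Lemma is_derive_arclength (c t0 t : R) : cos (t + t0) != 0 ->
  (F @` I) (c * tan (t + t0)) ->
  is_derive t 1 (fun t => pinv I F (c * tan (t + t0)))
    (c * sec (t + t0) ^+ 2 / f (pinv I F (c * tan (t + t0)))).
Proof.
move=> cos0 /pinv_image_mem; set s := pinv I F _ => -[Is Fs].
rewrite mulrC; apply: (@is_derive1_comp _ (pinv I F)).
  by rewrite -Fs; exact: (is_derive_pinv I_open I_itv FD f_neq0).
exact: is_derive_scaled_tan.
Qed.

End Arclength.

(** * The distance function of an f-rectifying curve *)

Section PositionVector.
Context (R : realType) (I : set R) (alpha : R -> 'rV[R]_3) (f : R -> R).
Hypotheses (I_neq0 : I !=set0) (I_open : open I) (I_itv : is_interval I).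
Hypotheses (alpha_curve : is_curve I alpha) (alpha_unit : unit_speed I alpha).
Hypothesis kappa_gt0 : forall s, I s -> 0 < curvature alpha s.
Hypothesis f_neq0 : forall s, I s -> f s != 0.

Local Notation T := (tangent alpha).
Local Notation T' := (derive1 (tangent alpha)).

Variable A : R -> 'rV[R]_3.
Hypothesis AD : antiderivative I (fun s => f s *: T s) A.
Hypothesis AT' : forall s, I s -> dot (A s) (T' s) = 0.

Local Notation F := (fun s => dot (A s) (T s)).

Lemma tangential_component_antiderivative : antiderivative I f F.
Proof.
move=> s Is; have := is_derive_dot (AD Is) (is_derive_tangent alpha_curve Is).
by rewrite AT' // add0r dotZl (dot_tangent alpha_unit) // mulr1.
Qed.

Lemma binormal_component_sqr s : I s ->
  dot (A s) (A s) = F s ^+ 2 + dot (A s) (binormal alpha s) ^+ 2.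
Proof.
move=> Is.
have A_eq := rectifying_planeP I_open alpha_curve alpha_unit kappa_gt0 Is (AT' Is).
rewrite {2}A_eq dotDr !dotZr; ring.
Qed.

(** Both |A|^2 and <A, T>^2 have derivative 2 f <A, T>, so their difference is a
    constant; the bulk of the proof is that this constant is not 0. *)
Lemma distance_sqr : exists2 c, 0 < c &
  forall s, I s -> dot (A s) (A s) = c ^+ 2 + F s ^+ 2.
Proof.
have FD := tangential_component_antiderivative.
pose q s := dot (A s) (A s) - F s ^+ 2.
have qD s : I s -> is_derive s 1 q 0.
  move=> Is; have := is_deriveB (is_derive_dot (AD Is) (AD Is)) (is_deriveX 2 (FD s Is)).
  rewrite !(dotZl, dotZr) [dot (T s) _]dotC.
  by congr is_derive; rewrite /GRing.scale /=; ring.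
have q_cst := derive0_cst_interval I_itv qD.
have [s0 Is0] := I_neq0.
have q_ge0 : 0 <= q s0.
  by rewrite /q binormal_component_sqr // addrAC subrr add0r sqr_ge0.
have q_neq0 : q s0 != 0.
  apply/eqP => q0.
  have A_eq s : I s -> A s = F s *: T s.
    move=> Is; have := q_cst _ _ Is Is0; rewrite q0 /q binormal_component_sqr //.
    rewrite addrAC subrr add0r => /eqP; rewrite sqrf_eq0 => /eqP AB.
    rewrite {1}(rectifying_planeP I_open alpha_curve alpha_unit kappa_gt0 Is (AT' Is)).
    by rewrite AB scale0r addr0.
  have F0 s : I s -> F s = 0.
    move=> Is; have FTD := is_derive_scale (FD s Is) (is_derive_tangent alpha_curve Is).
    have FTD' : is_derive s 1 (fun s => F s *: T s) (f s *: T s).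
      apply: (eq_open_is_derive I_open _ Is (AD Is)) => x /set_mem Ix.
      exact: A_eq.
    have := is_derive_unique FTD FTD'.
    move=> /(congr1 (dot (T' s))); rewrite dotDr !dotZr.
    rewrite dot_tangent_derive_self => /(canRL (addrK _)) /eqP.
    rewrite subrr mulf_eq0 sqrf_eq0 (gt_eqF (kappa_gt0 Is)) orbF.
    by move/eqP.
  have FD0 : is_derive s0 1 (cst 0) (f s0).
    apply: (@eq_open_is_derive R R^o I F (cst 0)) (FD _ Is0) => // x /set_mem.
    exact: F0.
  have := is_derive_unique FD0 (is_derive_cst 0 _ _).
  by move=> /eqP; apply/negP/f_neq0.
exists (Num.sqrt (q s0)) => [|s Is]; first by rewrite sqrtr_gt0 lt_neqAle eq_sym q_neq0.
by rewrite sqr_sqrtr // (q_cst _ _ Is0 Is) subrK.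
Qed.

End PositionVector.

(** * The characterization *)

(** The relation that the data c, t0, F, J, Y, P must satisfy for alpha to be
    given by the spherical curve Y; naming it lets the two implications be proved
    separately. *)
Definition spherical_param (R : realType) (I : set R) (alpha : R -> 'rV[R]_3)
    (f : R -> R) (c t0 : R) (F : R -> R) (J : set R) (Y P : R -> 'rV[R]_3) :=
  let s := fun t : R => pinv I F (c * tan (t + t0)) in
    [/\ 0 < c,
        [/\ antiderivative I f F, cos t0 != 0
          & F 0 = c * tan t0],
        [/\ open J, is_interval J, (forall t, J t -> cos (t + t0) != 0)
          & [set c * tan (t + t0) | t in J] = F @` I],
        [/\ is_curve J Y, Y @` J `<=` sphere2 R & ~ great_circle_arc J Y]
      & antiderivative J
          (fun t => (derive1 f (s t) * (sec (t + t0) / f (s t)) ^+ 3) *: Y t) P /\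
        forall t, J t ->
          alpha (s t) = (c * sec (t + t0) / f (s t)) *: Y t + c ^+ 2 *: P t].

Section Directions.
Context (R : realType) (I : set R) (alpha : R -> 'rV[R]_3) (f : R -> R).
Hypotheses (I_neq0 : I !=set0) (I_open : open I) (I_itv : is_interval I).
Hypotheses (alpha_curve : is_curve I alpha) (alpha_unit : unit_speed I alpha).
Hypothesis kappa_gt0 : forall s, I s -> 0 < curvature alpha s.
Hypothesis f_derivable : forall s, I s -> derivable f s 1.
Hypothesis f_neq0 : forall s, I s -> f s != 0.

Local Notation T := (tangent alpha).
Local Notation T' := (derive1 (tangent alpha)).

(** F is the tangential component <A, T>, and t + t0 the signed angle to A from the
    component of A along B, taken in the range of atan; J is the set of values of t
    taken on I, an open interval because t has derivative c f / (c^2 + F^2). *)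
Lemma f_rectifying_spherical_param : f_rectifying I alpha f ->
  exists c t0 F J Y P, spherical_param I alpha f c t0 F J Y P.
Proof.
move=> /(f_rectifyingP I_open alpha_curve alpha_unit kappa_gt0) [A AD AT'].
pose F s := dot (A s) (T s).
have FD : antiderivative I f F.
  exact (tangential_component_antiderivative alpha_curve alpha_unit AD AT').
have [c c_gt0 A_sqr] := distance_sqr I_neq0 I_open I_itv alpha_curve alpha_unit
  kappa_gt0 f_neq0 AD AT'.
have c0 : c != 0 by rewrite gt_eqF.
(* 0 may lie outside I; then the value F 0 carries no information, but F is a
   total function and this choice still meets the normalization of t0. *)
pose t0 := atan (F 0 / c).
have cos_atan0 x : cos (atan x) != 0 :> R.
  by rewrite gt_eqF // cos_gt0_pihalf // atan_gtNpi2 atan_ltpi2.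
pose theta s := atan (F s / c) - t0.
have thetaK s : c * tan (theta s + t0) = F s.
  by rewrite subrK atanK mulrC divfK.
have thetaD s : I s -> is_derive s 1 theta ((1 + (F s / c) ^+ 2)^-1 * (f s / c)).
  move=> Is; rewrite -[X in is_derive _ _ _ X]subr0.
  apply: is_deriveB; apply: is_derive1_comp.
  exact: is_derive_divr (FD s Is).
have theta'0 s : I s -> (1 + (F s / c) ^+ 2)^-1 * (f s / c) != 0.
  move=> Is; rewrite !(mulf_neq0, invr_neq0) ?f_neq0 //.
  by rewrite gt_eqF // ltr_pwDl // sqr_ge0.
pose J := theta @` I.
have cosJ t : J t -> cos (t + t0) != 0 by move=> [s _ <-]; rewrite subrK.
pose s t := pinv I F (c * tan (t + t0)).
have sK x : I x -> s (theta x) = x.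
  by move=> Ix; rewrite /s thetaK (pinv_derivableK I_itv FD f_neq0).
have J_open : open J by exact: open_derivable_image I_open I_itv thetaD theta'0.
have J_itv : is_interval J by exact: is_interval_derivable_image I_itv thetaD.
have Jtan : [set c * tan (t + t0) | t in J] = F @` I.
  apply/seteqP; split=> [_ [_ [x Ix <-] <-]|_ [x Ix <-]].
    by exists x; rewrite ?thetaK.
  by exists (theta x); [exists x|rewrite thetaK].
have sP t : J t -> I (s t) /\ F (s t) = c * tan (t + t0).
  by move=> Jt; apply: pinv_image_mem; rewrite -Jtan; exists t.
have sD t : J t -> is_derive t 1 s (c * sec (t + t0) ^+ 2 / f (s t)).
  move=> Jt; apply: (is_derive_arclength I_open I_itv FD f_neq0); first exact: cosJ.
  by rewrite -Jtan; exists t.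
have AsD t : J t ->
    is_derive t 1 (fun t => A (s t)) ((c * sec (t + t0) ^+ 2) *: T (s t)).
  move=> Jt; have [Is _] := sP t Jt.
  have := is_derive_comp_row (AD _ Is) (sD t Jt).
  by rewrite scalerA divfK // f_neq0.
have TsD t : J t -> is_derive t 1 (fun t => T (s t))
    ((c * sec (t + t0) ^+ 2 / f (s t)) *: T' (s t)).
  move=> Jt; have [Is _] := sP t Jt.
  exact: is_derive_comp_row (is_derive_tangent alpha_curve Is) (sD t Jt).
pose Y t := (cos (t + t0) / c) *: A (s t).
(* Since (A o s)' = c sec^2 (t + t0) T (s t), no factor f is left in Y', which is
   why Y is twice differentiable without any second derivative of f. *)
pose Y' t := sec (t + t0) *: T (s t) + (- sin (t + t0) / c) *: A (s t).
have YD t : J t -> is_derive t 1 Y (Y' t).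
  move=> Jt; have cos0 := cosJ t Jt.
  have -> : Y' t = (cos (t + t0) / c) *: ((c * sec (t + t0) ^+ 2) *: T (s t)) +
      (- sin (t + t0) / c) *: A (s t).
    rewrite scalerA; congr (_ *: _ + _); rewrite /sec; field.
    by rewrite c0 cos0.
  apply: is_derive_scale (AsD t Jt); apply: is_derive_divr.
  exact: is_derive_shifted_cos.
exists c, t0, F, J, Y, (fun t => c ^- 2 *: (alpha (s t) - (f (s t))^-1 *: A (s t))).
split=> //.
- by split=> //; [exact: cos_atan0|rewrite atanK mulrC divfK].
- split.
  + move=> t Jt; split; first by have [] := YD t Jt.
    have Y'D : derivable Y' t 1.
      have := is_deriveD
        (is_derive_scale (is_derive_shifted_sec (cosJ t Jt)) (TsD t Jt))
        (is_derive_scale (is_derive_divr c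
          (is_deriveN (is_derive_shifted_sin t0 t))) (AsD t Jt)).
      by case.
    apply: near_eq_derivable Y'D; near=> u.
    have Ju : J u by near: u; exact: open_nbhs_nbhs.
    by rewrite derive1E; have [_ ->] := YD u Ju.
  + move=> _ [t Jt <-]; apply/enorm_eq1; rewrite !(dotZl, dotZr).
    have [Is Fs] := sP t Jt.
    have -> : dot (A (s t)) (A (s t)) = c ^+ 2 * sec (t + t0) ^+ 2.
      by rewrite A_sqr // -/(F _) Fs sec_sqr ?cosJ //; ring.
    rewrite /sec; have cos0 := cosJ t Jt; field.
    by rewrite c0 cos0.
  + move=> [n n0 nY]; move/negP: n0; apply; apply/eqP.
    have nA x : I x -> dot n (A x) = 0.
      move=> Ix; have Jx : J (theta x) by exists x.
      have [_] := nY _ (ex_intro2 _ _ _ Jx erefl).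
      rewrite /= dotZr sK // => /eqP; rewrite mulf_eq0 => /orP [|/eqP//].
      by rewrite mulf_eq0 invr_eq0 (negPf c0) (negPf (cosJ _ Jx)).
    have nT x : I x -> dot n (T x) = 0.
      move=> Ix; have := dot_derive_eq0 I_open nA Ix (AD x Ix).
      by rewrite dotZr => /eqP; rewrite mulf_eq0 (negPf (f_neq0 Ix)) => /eqP.
    have nT' x : I x -> dot n (T' x) = 0.
      move=> Ix; exact: dot_derive_eq0 I_open nT Ix (is_derive_tangent alpha_curve Ix).
    have [x Ix] := I_neq0.
    have AB0 : dot (A x) (binormal alpha x) != 0.
      rewrite -sqrf_eq0; have := A_sqr x Ix.
      rewrite (binormal_component_sqr I_open alpha_curve alpha_unit kappa_gt0 AT') //.
      by rewrite addrC => /addIr ->; rewrite expf_neq0.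
    apply: (frame_eq0 I_open alpha_curve alpha_unit kappa_gt0 Ix (nT x Ix) (nT' x Ix)).
    have := nA x Ix.
    rewrite (rectifying_planeP I_open alpha_curve alpha_unit kappa_gt0 Ix (AT' x Ix)).
    rewrite dotDr !dotZr nT // mulr0 add0r => /eqP.
    by rewrite mulf_eq0 (negPf AB0) => /eqP.
- split=> [t Jt|t Jt]; last first.
    rewrite /= [c ^+ 2 *: _]scalerA divff ?expf_neq0 // scale1r /Y scalerA.
    rewrite [X in X *: _](_ : _ = (f (s t))^-1) ?subrKC //.
    have [Is _] := sP t Jt; rewrite /sec; have cos0 := cosJ t Jt.
    by field; rewrite c0 cos0 f_neq0.
  have [Is _] := sP t Jt; have cos0 := cosJ t Jt; have fs0 := f_neq0 Is.
  have fsD := is_derive1_comp (derivable_is_derive1 (f_derivable Is)) (sD t Jt).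
  have := is_deriveZ (c ^- 2) (is_deriveB
    (is_derive_comp_row (is_derive_curve alpha_curve Is) (sD t Jt))
    (is_derive_scale (is_deriveV (f := f \o s) fs0 fsD) (AsD t Jt))).
  congr is_derive; apply/rowP => i; rewrite !mxE /GRing.scale /= /sec -/(s t).
  by field; rewrite c0 cos0 fs0.
Unshelve. all: by end_near. Qed.

(** Differentiating alpha (s t) = f^-1 W + c^2 P with W = c sec(t + t0) Y, the
    derivative of f^-1 cancels that of P, leaving W' = c sec^2(t + t0) T. As
    tau is the inverse of s, the chain rule turns this into (W o tau)' = f T. *)
Lemma spherical_param_f_rectifying c t0 F J Y P :
  spherical_param I alpha f c t0 F J Y P -> f_rectifying I alpha f.
Proof.
move=> [c_gt0 [FD _ _] [J_open J_itv cosJ Jtan] [YC YS _] [PD alphaE]].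
have c0 : c != 0 by rewrite gt_eqF.
pose s t := pinv I F (c * tan (t + t0)).
pose ctan t := c * tan (t + t0).
have sP t : J t -> I (s t) /\ F (s t) = ctan t.
  by move=> Jt; apply: pinv_image_mem; rewrite -Jtan; exists t.
have sD t : J t -> is_derive t 1 s (c * sec (t + t0) ^+ 2 / f (s t)).
  move=> Jt; apply: (is_derive_arclength I_open I_itv FD f_neq0); first exact: cosJ.
  by rewrite -Jtan; exists t.
have ctanD t : J t -> is_derive t 1 ctan (c * sec (t + t0) ^+ 2).
  by move=> Jt; apply: is_derive_scaled_tan; exact: cosJ.
have ctan'0 t : J t -> c * sec (t + t0) ^+ 2 != 0.
  by move=> Jt; rewrite mulf_neq0 // expf_neq0 // invr_neq0 // cosJ.
pose tau x := pinv J ctan (F x).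
have tauP x : I x -> J (tau x) /\ ctan (tau x) = F x.
  by move=> Ix; apply: pinv_image_mem; rewrite [ctan @` J]Jtan; exists x.
have tauD x : I x -> is_derive x 1 tau ((c * sec (tau x + t0) ^+ 2)^-1 * f x).
  move=> Ix; have [Jt Ft] := tauP x Ix.
  apply: (@is_derive1_comp _ (pinv J ctan)); last exact: FD.
  by rewrite -Ft; exact (is_derive_pinv J_open J_itv ctanD ctan'0 Jt).
have tauK x : I x -> s (tau x) = x.
  move=> Ix; have [_ Ft] := tauP x Ix.
  by rewrite /s -/(ctan _) Ft (pinv_derivableK I_itv FD f_neq0).
pose W t := (c * sec (t + t0)) *: Y t.
have WD t : J t -> is_derive t 1 W ((c * sec (t + t0) ^+ 2) *: T (s t)).
  move=> Jt; have [Is _] := sP t Jt; have cos0 := cosJ t Jt.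
  have fs0 := f_neq0 Is.
  have [/derivable_is_derive1 YD _] := YC t Jt.
  have {}YD := is_derive_scale (is_deriveZ c (is_derive_shifted_sec cos0)) YD.
  set dW := (X in is_derive _ _ _ X) in YD.
  have fsD := is_derive1_comp (derivable_is_derive1 (f_derivable Is)) (sD t Jt).
  have rhsD := is_deriveD
    (is_derive_scale (is_deriveV (f := f \o s) fs0 fsD) YD)
    (is_deriveZ (c ^+ 2) (PD t Jt)).
  have lhsD := is_derive_comp_row (is_derive_curve alpha_curve Is) (sD t Jt).
  have lhsD' := eq_open_is_derive (h := fun t => (f (s t))^-1 *: W t + c ^+ 2 *: P t)
    J_open _ Jt lhsD.
  have /lhsD' {}lhsD' : {in J, (fun t => alpha (s t)) =1
      fun t => (f (s t))^-1 *: W t + c ^+ 2 *: P t}.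
    by move=> u /set_mem Ju; rewrite alphaE // /W scalerA [_^-1 * _]mulrC.
  have dE := is_derive_unique lhsD' rhsD.
  suff <- : dW = (c * sec (t + t0) ^+ 2) *: T (s t) by [].
  move: dE; clearbody dW; rewrite /= -/(s t) => dE.
  (* The two sides of dE are compared in each coordinate and solved for dW. *)
  apply/rowP => i; have := congr1 (fun v : 'rV[R]_3 => f (s t) * v 0 i) dE.
  rewrite !mxE /GRing.scale /= => dEi.
  have -> : c * sec (t + t0) ^+ 2 * T (s t) 0 i =
      f (s t) * (c * sec (t + t0) ^+ 2 / f (s t) * T (s t) 0 i) by field.
  by rewrite dEi; field.
pose A x := W (tau x).
have AD : antiderivative I (fun x => f x *: T x) A.
  move=> x Ix; have [Jt _] := tauP x Ix.
  have := is_derive_comp_row (WD _ Jt) (tauD x Ix).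
  by rewrite tauK // scalerA mulrAC mulVf ?mul1r // ctan'0.
have A_sqr x : I x -> dot (A x) (A x) = c ^+ 2 + F x ^+ 2.
  move=> Ix; have [Jt <-] := tauP x Ix.
  have /enorm_eq1 YY : enorm (Y (tau x)) = 1 by apply: YS; exists (tau x).
  rewrite dotZl dotZr YY mulr1 -expr2 exprMn sec_sqr ?cosJ // /ctan; ring.
have AT x : I x -> dot (A x) (T x) = F x.
  move=> Ix.
  have AAD := is_derive_dot (AD x Ix) (AD x Ix).
  have AAD' : is_derive x 1 (fun x => dot (A x) (A x)) (2 * F x * f x).
    have : is_derive x 1 (cst (c ^+ 2) + F ^+ 2) (2 * F x * f x).
      have := is_deriveD (is_derive_cst (c ^+ 2) _ _) (is_deriveX 2 (FD x Ix)).
      by congr is_derive; rewrite add0r /GRing.scale /= expr1.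
    apply: (@eq_open_is_derive _ R^o I) => // y /set_mem Iy.
    by rewrite A_sqr.
  have := is_derive_unique AAD AAD'; rewrite dotZl dotZr [dot (T x) _]dotC => eqf.
  apply: (mulfI (f_neq0 Ix)); lra.
apply/(f_rectifyingP I_open alpha_curve alpha_unit kappa_gt0).
exists A => // x Ix.
have ATD := is_derive_dot (AD x Ix) (is_derive_tangent alpha_curve Ix).
have ATD' : is_derive x 1 (fun x => dot (A x) (T x)) (f x).
  apply: (@eq_open_is_derive _ R^o I F) (FD x Ix) => // y /set_mem Iy.
  by rewrite AT.
have := is_derive_unique ATD ATD'.
by rewrite dotZl (dot_tangent alpha_unit) // mulr1 => /(canRL (addrK _)); rewrite subrr.
Qed.

End Directions.

Theorem theorem4 (R : realType) (I : set R) (alpha : R -> 'rV[R]_3) (f : R -> R)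
    (I_neq0 : I !=set0) (I_open : open I) (I_itv : is_interval I)
    (alpha_curve : is_curve I alpha) (alpha_unit : unit_speed I alpha)
    (kappa_gt0 : forall s, I s -> 0 < curvature alpha s)
    (f_derivable : forall s, I s -> derivable f s 1)
    (f_neq0 : forall s, I s -> f s != 0) :
  f_rectifying I alpha f <->
  exists (c t0 : R) (F : R -> R) (J : set R) (Y P : R -> 'rV[R]_3),
    (* the arclength parameter F^-1 (c tan (t + t0)) of the point alpha(t) *)
    let s := fun t : R => pinv I F (c * tan (t + t0)) in
    [/\ 0 < c,
        [/\ antiderivative I f F, cos t0 != 0
          & F 0 = c * tan t0],
        (* t ranges over J: sec and tan are defined and t |-> s t maps J onto I *)
        [/\ open J, is_interval J, (forall t, J t -> cos (t + t0) != 0)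
          & [set c * tan (t + t0) | t in J] = F @` I],
        [/\ is_curve J Y, Y @` J `<=` sphere2 R & ~ great_circle_arc J Y]
      & (* P is the indefinite integral occurring in the formula *)
        (* integrating T ds = f^-1 d(alpha_f) by parts, with
           alpha_f = c sec(t + t0) Y, makes it enter with a plus sign *)
        antiderivative J
          (fun t => (derive1 f (s t) * (sec (t + t0) / f (s t)) ^+ 3) *: Y t) P /\
        forall t, J t ->
          alpha (s t) = (c * sec (t + t0) / f (s t)) *: Y t + c ^+ 2 *: P t].
Proof.
split=> [rect|[c [t0 [F [J [Y [P dataP]]]]]]].
  exact (f_rectifying_spherical_param I_neq0 I_open I_itv alpha_curve alpha_unit
    kappa_gt0 f_derivable f_neq0 rect).
exact (spherical_param_f_rectifying I_open I_itv alpha_curve alpha_unit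
  kappa_gt0 f_derivable f_neq0 dataP).
Qed.
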